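(* Any algebraically coherent semi-abelian category is strongly protomodular.
   Context: A category is semi-abelian if it is pointed, Barr exact, protomodular and has binary coproducts. A category is protomodular if it has pullbacks of split epimorphisms along any map and all change-of-base functors between its categories of points (defined below) reflect isomorphisms. A cospan $(f\colon X\to Z,\ g\colon Y\to Z)$ in a category with finite limits is jointly strongly epimorphic if every monomorphism into $Z$ through which both $f$ and $g$ factor is an isomorphism. A functor between categories with finite limits is coherent if it preserves finite limits and jointly strongly epimorphic pairs. $\mathsf{Pt}_X(\mathcal{C})$ is the category of points over $X$: objects are triples $(A,\ p\colon A\to X,\ s\colon X\to A)$ with $ps=1_X$, and morphisms are morphisms between the objects $A$ commuting with the $p$'s and the $s$'s; it is pointed with zero object $(X,1_X,1_X)$. For $f\colon X\to Y$, the change-of-base functor $f^*\colon \mathsf{Pt}_Y(\mathcal{C})\to\mathsf{Pt}_X(\mathcal{C})$ is pulling back along $f$. A category $\mathcal{C}$ with finite limits is algebraically coherent if $f^*$ is coherent for every morphism $f$ of $\mathcal{C}$. In a pointed category with finite limits, a monomorphism is Bourn-normal if it is the normalisation $r_2\circ\ker(r_1)$ of some equivalence relation $(R,r_1,r_2)$ on its codomain. A pointed protomodular category $\mathcal{C}$ is strongly protomodular if for every morphism $f\colon X\to Y$ of $\mathcal{C}$ the change-of-base functor $f^*\colon\mathsf{Pt}_Y(\mathcal{C})\to\mathsf{Pt}_X(\mathcal{C})$ reflects Bourn-normal monomorphisms. *)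

(* Defs.v *)
From Stdlib Require Import ClassicalEpsilon RelationClasses List.
From Stdlib Require FinFun.

Set Implicit Arguments.
Unset Strict Implicit.
Unset Printing Implicit Defensive.

(** * Categories and functors *)

Record Category : Type := {
  Ob :> Type;
  Hom : Ob -> Ob -> Type;
  id : forall A, Hom A A;
  comp : forall A B C, Hom B C -> Hom A B -> Hom A C;
  comp_assoc : forall A B C D (h : Hom C D) (g : Hom B C) (f : Hom A B),
    comp h (comp g f) = comp (comp h g) f;
  comp_id_l : forall A B (f : Hom A B), comp (id B) f = f;
  comp_id_r : forall A B (f : Hom A B), comp f (id A) = f
}.

Arguments Hom {c} _ _.
Arguments id {c} A.
Arguments comp {c A B C} _ _.

Declare Scope cat_scope.
Delimit Scope cat_scope with cat.
Open Scope cat_scope.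
Notation "g ∘ f" := (comp g f) (at level 40, left associativity) : cat_scope.

Record Functor (C D : Category) : Type := {
  fob :> C -> D;
  fmap : forall A B : C, Hom A B -> Hom (fob A) (fob B);
  fmap_id : forall A : C, fmap (id A) = id (fob A);
  fmap_comp : forall (A B E : C) (g : Hom B E) (f : Hom A B),
    fmap (g ∘ f) = fmap g ∘ fmap f
}.

Arguments fmap {C D} _ {A B} _.

Section FunctorComposition.
Variables (B C D : Category) (G : Functor C D) (F : Functor B C).

Lemma functor_comp_id (A : B) : fmap G (fmap F (id A)) = id (G (F A)).
Proof. now rewrite !fmap_id. Qed.

Lemma functor_comp_comp (A A' A'' : B) (g : Hom A' A'') (f : Hom A A') :
  fmap G (fmap F (g ∘ f)) = fmap G (fmap F g) ∘ fmap G (fmap F f).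
Proof. now rewrite !fmap_comp. Qed.

Definition functor_comp : Functor B D :=
  {| fob := fun A => G (F A);
     fmap := fun A A' (f : Hom A A') => fmap G (fmap F f);
     fmap_id := functor_comp_id;
     fmap_comp := functor_comp_comp |}.
End FunctorComposition.

(** * Morphisms *)

Definition is_iso {C : Category} {A B : C} (f : Hom A B) : Prop :=
  exists g : Hom B A, g ∘ f = id A /\ f ∘ g = id B.

Definition is_mono {C : Category} {A B : C} (f : Hom A B) : Prop :=
  forall (T : C) (a b : Hom T A), f ∘ a = f ∘ b -> a = b.

Definition is_coequalizer {C : Category} {A B Q : C}
    (u v : Hom A B) (q : Hom B Q) : Prop :=
  q ∘ u = q ∘ v /\
  forall (T : C) (t : Hom B T), t ∘ u = t ∘ v -> exists! h : Hom Q T, h ∘ q = t.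

Definition is_regular_epi {C : Category} {B Q : C} (q : Hom B Q) : Prop :=
  exists (A : C) (u v : Hom A B), is_coequalizer u v q.

Definition jointly_strongly_epi {C : Category} {X Y Z : C}
    (f : Hom X Z) (g : Hom Y Z) : Prop :=
  forall (M : C) (m : Hom M Z), is_mono m ->
    (exists f' : Hom X M, m ∘ f' = f) ->
    (exists g' : Hom Y M, m ∘ g' = g) ->
    is_iso m.

(** * Finite limits *)

Definition finite_category (J : Category) : Prop :=
  FinFun.Finite J /\ forall a b : J, FinFun.Finite (Hom a b).

Record Cone {J C : Category} (D : Functor J C) : Type := {
  apex : C;
  leg : forall j : J, Hom apex (D j);
  leg_natural : forall (i j : J) (u : Hom i j), fmap D u ∘ leg i = leg j
}.

Definition is_limit {J C : Category} {D : Functor J C} (c : Cone D) : Prop :=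
  forall c' : Cone D,
    exists! u : Hom (apex c') (apex c), forall j, leg c j ∘ u = leg c' j.

Definition has_finite_limits (C : Category) : Prop :=
  forall J : Category, finite_category J ->
  forall D : Functor J C, exists c : Cone D, is_limit c.

Section MapCone.
Variables (J C E : Category) (F : Functor C E) (D : Functor J C) (c : Cone D).

Lemma map_cone_natural (i j : J) (u : Hom i j) :
  fmap (functor_comp F D) u ∘ fmap F (leg c i) = fmap F (leg c j).
Proof. cbn. now rewrite <- fmap_comp, leg_natural. Qed.

Definition map_cone : Cone (functor_comp F D) :=
  @Build_Cone J E (functor_comp F D) (F (apex c))
    (fun j => fmap F (leg c j)) map_cone_natural.
End MapCone.

Definition preserves_finite_limits {C E : Category} (F : Functor C E) : Prop :=
  forall J : Category, finite_category J ->
  forall (D : Functor J C) (c : Cone D), is_limit c -> is_limit (map_cone F c).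

(** * Pullbacks *)

Definition is_pullback {C : Category} {P X Y Z : C} (f : Hom X Z) (g : Hom Y Z)
    (p1 : Hom P X) (p2 : Hom P Y) : Prop :=
  f ∘ p1 = g ∘ p2 /\
  forall (T : C) (a : Hom T X) (b : Hom T Y), f ∘ a = g ∘ b ->
    exists! u : Hom T P, p1 ∘ u = a /\ p2 ∘ u = b.

Record Pullback {C : Category} {X Y Z : C} (f : Hom X Z) (g : Hom Y Z) : Type := {
  pb_ob : C;
  pb_fst : Hom pb_ob X;
  pb_snd : Hom pb_ob Y;
  pb_is_pullback : is_pullback f g pb_fst pb_snd
}.

Definition has_split_epi_pullbacks (C : Category) : Prop :=
  forall (X Y A : C) (f : Hom X Y) (p : Hom A Y) (s : Hom Y A),
    p ∘ s = id Y -> inhabited (Pullback f p).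

Section PullbackLift.
Variables (C : Category) (X Y Z : C) (f : Hom X Z) (g : Hom Y Z).
Variable P : Pullback f g.
Variables (T : C) (a : Hom T X) (b : Hom T Y).
Hypothesis e : f ∘ a = g ∘ b.

Lemma pb_lift_exists :
  exists u : Hom T (pb_ob P), pb_fst P ∘ u = a /\ pb_snd P ∘ u = b.
Proof.
  destruct (proj2 (pb_is_pullback P) T a b e) as [u [Hu _]]. now exists u.
Qed.

Definition pb_lift : Hom T (pb_ob P) :=
  proj1_sig (constructive_indefinite_description _ pb_lift_exists).

Lemma pb_fst_lift : pb_fst P ∘ pb_lift = a.
Proof.
  exact (proj1 (proj2_sig (constructive_indefinite_description _ pb_lift_exists))).
Qed.

Lemma pb_snd_lift : pb_snd P ∘ pb_lift = b.
Proof.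
  exact (proj2 (proj2_sig (constructive_indefinite_description _ pb_lift_exists))).
Qed.
End PullbackLift.

Lemma pb_comm {C : Category} {X Y Z : C} {f : Hom X Z} {g : Hom Y Z}
  (P : Pullback f g) : f ∘ pb_fst P = g ∘ pb_snd P.
Proof. exact (proj1 (pb_is_pullback P)). Qed.

Lemma pb_ext {C : Category} {X Y Z : C} {f : Hom X Z} {g : Hom Y Z}
  (P : Pullback f g) (T : C) (u v : Hom T (pb_ob P)) :
  pb_fst P ∘ u = pb_fst P ∘ v -> pb_snd P ∘ u = pb_snd P ∘ v -> u = v.
Proof.
  intros H1 H2.
  assert (e : f ∘ (pb_fst P ∘ v) = g ∘ (pb_snd P ∘ v))
    by now rewrite !comp_assoc, pb_comm.
  destruct (proj2 (pb_is_pullback P) T _ _ e) as [w [_ Hw]].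
  transitivity w; [symmetry|]; apply Hw; now split.
Qed.

Inductive cospan_ob : Type := cospan_l | cospan_r | cospan_m.

Definition cospan_hom (a b : cospan_ob) : Type :=
  match a, b with
  | cospan_l, cospan_l | cospan_r, cospan_r | cospan_m, cospan_m
  | cospan_l, cospan_m | cospan_r, cospan_m => unit
  | _, _ => Empty_set
  end.

Definition cospan_shape : Category.
Proof.
  refine {| Ob := cospan_ob; Hom := cospan_hom;
    id := fun a => match a with cospan_l | cospan_r | cospan_m => tt end;
    comp := fun a b c =>
      match a, b, c return cospan_hom b c -> cospan_hom a b -> cospan_hom a c with
      | cospan_l, cospan_l, cospan_l | cospan_l, cospan_l, cospan_m
      | cospan_l, cospan_m, cospan_m | cospan_r, cospan_r, cospan_r
      | cospan_r, cospan_r, cospan_m | cospan_r, cospan_m, cospan_m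
      | cospan_m, cospan_m, cospan_m => fun _ _ => tt
      | _, _, _ => fun g f =>
          ltac:(first [exact (match f with end) | exact (match g with end)])
      end |}.
  - intros [] [] [] [] h g f; cbn in *; now try destruct h, g, f.
  - intros [] [] f; cbn in *; now destruct f.
  - intros [] [] f; cbn in *; now destruct f.
Defined.

Lemma cospan_shape_finite : finite_category cospan_shape.
Proof.
  split.
  - exists (cospan_l :: cospan_r :: cospan_m :: nil). intros []; cbn; tauto.
  - intros [] [];
      first [ exists (tt :: nil); intros []; now left | exists nil; intros [] ].
Qed.

Section CospanDiagram.
Variables (C : Category) (X Y Z : C) (f : Hom X Z) (g : Hom Y Z).

Definition cospan_diagram : Functor cospan_shape C.
Proof.
  refine (@Build_Functor cospan_shape C
    (fun a => match a with cospan_l => X | cospan_r => Y | cospan_m => Z end)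
    (fun a b =>
      match a, b return cospan_hom a b ->
        Hom (match a with cospan_l => X | cospan_r => Y | cospan_m => Z end)
            (match b with cospan_l => X | cospan_r => Y | cospan_m => Z end) with
      | cospan_l, cospan_l => fun _ => id X
      | cospan_r, cospan_r => fun _ => id Y
      | cospan_m, cospan_m => fun _ => id Z
      | cospan_l, cospan_m => fun _ => f
      | cospan_r, cospan_m => fun _ => g
      | _, _ => fun u => match u with end
      end) _ _).
  - now intros [].
  - intros [] [] [] v u; cbn in *; try destruct u; try destruct v;
      now rewrite ?comp_id_l, ?comp_id_r.
Defined.

Definition cospan_cone (T : C) (a : Hom T X) (b : Hom T Y) (e : f ∘ a = g ∘ b) :
  Cone cospan_diagram.
Proof.
  refine (@Build_Cone cospan_shape C cospan_diagram T
    (fun j => match j return Hom T (cospan_diagram j) with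
              | cospan_l => a | cospan_r => b | cospan_m => f ∘ a end) _).
  intros [] [] u; cbn in *; try destruct u; rewrite ?comp_id_l; congruence.
Defined.
End CospanDiagram.

Lemma finite_limits_pullback (C : Category) (H : has_finite_limits C)
  (X Y Z : C) (f : Hom X Z) (g : Hom Y Z) : inhabited (Pullback f g).
Proof.
  destruct (H _ cospan_shape_finite (cospan_diagram f g)) as [c Hc].
  pose (l := leg c : forall j, Hom (apex c) (cospan_diagram f g j)).
  assert (El : f ∘ l cospan_l = l cospan_m)
    by exact (leg_natural c (tt : @Hom cospan_shape cospan_l cospan_m)).
  assert (Er : g ∘ l cospan_r = l cospan_m)
    by exact (leg_natural c (tt : @Hom cospan_shape cospan_r cospan_m)).
  constructor.
  apply (@Build_Pullback _ _ _ _ f g (apex c) (l cospan_l) (l cospan_r)).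
  split.
  - now transitivity (l cospan_m).
  - intros T a b e.
    destruct (Hc (cospan_cone e)) as [u [Hu Uu]].
    exists u. split.
    + split; [exact (Hu cospan_l) | exact (Hu cospan_r)].
    + intros v [Ha Hb]. apply Uu. intros []; [exact Ha | exact Hb |].
      change (l cospan_m ∘ v = f ∘ a).
      now rewrite <- El, <- comp_assoc, Ha.
Qed.

Lemma finite_limits_split_epi_pullbacks (C : Category) :
  has_finite_limits C -> has_split_epi_pullbacks C.
Proof. intros H X Y A f p s _. now apply finite_limits_pullback. Qed.

(** * Points *)

Section Points.
Variables (C : Category) (X : C).

Record pt_ob : Type := {
  pt_dom : C;
  pt_proj : Hom pt_dom X;
  pt_sec : Hom X pt_dom;
  pt_split : pt_proj ∘ pt_sec = id X
}.

Record pt_hom (a b : pt_ob) : Type := {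
  pt_map : Hom (pt_dom a) (pt_dom b);
  pt_map_proj : pt_proj b ∘ pt_map = pt_proj a;
  pt_map_sec : pt_map ∘ pt_sec a = pt_sec b
}.

Lemma pt_hom_eq (a b : pt_ob) (u v : pt_hom a b) : pt_map u = pt_map v -> u = v.
Proof.
  destruct u as [u pu su], v as [v pv sv]; cbn; intros <-.
  f_equal; apply proof_irrelevance.
Qed.

Definition pt_id (a : pt_ob) : pt_hom a a :=
  {| pt_map := id (pt_dom a);
     pt_map_proj := comp_id_r (pt_proj a);
     pt_map_sec := comp_id_l (pt_sec a) |}.

Definition pt_comp (a b c : pt_ob) (v : pt_hom b c) (u : pt_hom a b) : pt_hom a c.
Proof.
  refine {| pt_map := pt_map v ∘ pt_map u |}.
  - now rewrite comp_assoc, !pt_map_proj.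
  - now rewrite <- comp_assoc, !pt_map_sec.
Defined.

Definition Pt : Category.
Proof.
  refine {| Ob := pt_ob; Hom := pt_hom; id := pt_id; comp := pt_comp |}.
  - intros. apply pt_hom_eq. apply comp_assoc.
  - intros. apply pt_hom_eq. apply comp_id_l.
  - intros. apply pt_hom_eq. apply comp_id_r.
Defined.
End Points.

Arguments Pt {C} X.

(** The pullbacks are selected by [epsilon] from their mere existence, so that
    [change_of_base] is one determined functor, as with a fixed choice of
    pullbacks. *)

Section ChangeOfBase.
Variables (C : Category) (H : has_split_epi_pullbacks C) (X Y : C) (f : Hom X Y).

Definition cob_pb (a : Pt Y) : Pullback f (pt_proj a) :=
  epsilon (H f (pt_split a)) (fun _ => True).

Lemma cob_sec_comm (a : Pt Y) : f ∘ id X = pt_proj a ∘ (pt_sec a ∘ f).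
Proof. now rewrite comp_assoc, pt_split, comp_id_l, comp_id_r. Qed.

Definition cob_ob (a : Pt Y) : Pt X :=
  {| pt_dom := pb_ob (cob_pb a);
     pt_proj := pb_fst (cob_pb a);
     pt_sec := pb_lift (cob_pb a) (cob_sec_comm a);
     pt_split := pb_fst_lift (cob_pb a) (cob_sec_comm a) |}.

Lemma cob_map_comm (a b : Pt Y) (u : Hom a b) :
  f ∘ pb_fst (cob_pb a) = pt_proj b ∘ (pt_map u ∘ pb_snd (cob_pb a)).
Proof. now rewrite comp_assoc, pt_map_proj, pb_comm. Qed.

Definition cob_map (a b : Pt Y) (u : Hom a b) : Hom (cob_ob a) (cob_ob b).
Proof.
  refine (@Build_pt_hom C X (cob_ob a) (cob_ob b)
            (pb_lift (cob_pb b) (cob_map_comm u)) _ _).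
  - apply pb_fst_lift.
  - apply pb_ext; cbn; rewrite comp_assoc, ?pb_fst_lift, ?pb_snd_lift.
    + reflexivity.
    + now rewrite <- comp_assoc, pb_snd_lift, comp_assoc, pt_map_sec.
Defined.

Definition change_of_base : Functor (Pt Y) (Pt X).
Proof.
  refine {| fob := cob_ob; fmap := cob_map |}.
  - intros a. apply pt_hom_eq, pb_ext; cbn; rewrite ?pb_fst_lift, ?pb_snd_lift.
    + now rewrite comp_id_r.
    + now rewrite comp_id_l, comp_id_r.
  - intros a b c v u. apply pt_hom_eq, pb_ext; cbn;
      rewrite comp_assoc, ?pb_fst_lift, ?pb_snd_lift.
    + reflexivity.
    + now rewrite <- !comp_assoc, pb_snd_lift.
Defined.
End ChangeOfBase.

Arguments change_of_base {C} H {X Y} f.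

(** * Algebraically coherent categories *)

Record coherent {C D : Category} (F : Functor C D) : Prop := {
  coherent_limits : preserves_finite_limits F;
  coherent_jse : forall (X Y Z : C) (f : Hom X Z) (g : Hom Y Z),
    jointly_strongly_epi f g -> jointly_strongly_epi (fmap F f) (fmap F g)
}.

Record algebraically_coherent (C : Category) : Prop := {
  ac_finite_limits : has_finite_limits C;
  ac_coherent : forall (X Y : C) (f : Hom X Y),
    coherent (change_of_base (finite_limits_split_epi_pullbacks ac_finite_limits) f)
}.

(** * Semi-abelian categories *)

Definition is_zero_object {C : Category} (Z : C) : Prop :=
  (forall A : C, exists! f : Hom A Z, True) /\
  (forall A : C, exists! f : Hom Z A, True).

Definition pointed (C : Category) : Prop := exists Z : C, is_zero_object Z.

Definition is_zero_map {C : Category} {A B : C} (f : Hom A B) : Prop :=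
  exists (Z : C) (a : Hom A Z) (b : Hom Z B), is_zero_object Z /\ f = b ∘ a.

Definition is_kernel {C : Category} {K A B : C} (f : Hom A B) (k : Hom K A) : Prop :=
  is_zero_map (f ∘ k) /\
  forall (T : C) (t : Hom T A), is_zero_map (f ∘ t) -> exists! u : Hom T K, k ∘ u = t.

Definition has_binary_coproducts (C : Category) : Prop :=
  forall A B : C, exists (S : C) (i : Hom A S) (j : Hom B S),
    forall (T : C) (a : Hom A T) (b : Hom B T),
      exists! u : Hom S T, u ∘ i = a /\ u ∘ j = b.

(** A jointly monic pair such that, for every [T], the induced relation on
    [Hom T X] is an equivalence relation. *)
Record equivalence_relation {C : Category} {R X : C} (r1 r2 : Hom R X) : Prop := {
  er_jointly_monic : forall (T : C) (a b : Hom T R),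
    r1 ∘ a = r1 ∘ b -> r2 ∘ a = r2 ∘ b -> a = b;
  er_equivalence : forall T : C,
    Equivalence (fun x y : Hom T X => exists a : Hom T R, r1 ∘ a = x /\ r2 ∘ a = y)
}.

Record regular (C : Category) : Prop := {
  regular_finite_limits : has_finite_limits C;
  regular_coequalizers : forall (A B P : C) (f : Hom A B) (p1 p2 : Hom P A),
    is_pullback f f p1 p2 -> exists (Q : C) (q : Hom A Q), is_coequalizer p1 p2 q;
  regular_stable : forall (P X Y Z : C) (f : Hom X Z) (g : Hom Y Z)
    (p1 : Hom P X) (p2 : Hom P Y),
    is_pullback f g p1 p2 -> is_regular_epi g -> is_regular_epi p1
}.

Record barr_exact (C : Category) : Prop := {
  exact_regular : regular C;
  exact_effective : forall (R X : C) (r1 r2 : Hom R X),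
    equivalence_relation r1 r2 ->
    exists (Y : C) (f : Hom X Y), is_pullback f f r1 r2
}.

Definition reflects_isos {C D : Category} (F : Functor C D) : Prop :=
  forall (A B : C) (f : Hom A B), is_iso (fmap F f) -> is_iso f.

Record protomodular (C : Category) : Prop := {
  pm_pullbacks : has_split_epi_pullbacks C;
  pm_reflects_isos : forall (X Y : C) (f : Hom X Y),
    reflects_isos (change_of_base pm_pullbacks f)
}.

Record semi_abelian (C : Category) : Prop := {
  sa_pointed : pointed C;
  sa_exact : barr_exact C;
  sa_protomodular : protomodular C;
  sa_coproducts : has_binary_coproducts C
}.

(** * Strong protomodularity *)

Definition bourn_normal {C : Category} {M X : C} (m : Hom M X) : Prop :=
  is_mono m /\
  exists (R : C) (r1 r2 : Hom R X) (k : Hom M R),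
    equivalence_relation r1 r2 /\ is_kernel r1 k /\ m = r2 ∘ k.

Definition reflects_bourn_normal_monos {C D : Category} (F : Functor C D) : Prop :=
  forall (M X : C) (m : Hom M X), bourn_normal (fmap F m) -> bourn_normal m.

Record strongly_protomodular (C : Category) : Prop := {
  sp_pointed : pointed C;
  sp_protomodular : protomodular C;
  sp_reflects : forall (X Y : C) (f : Hom X Y),
    reflects_bourn_normal_monos (change_of_base (pm_pullbacks sp_protomodular) f)
}.

(* Main.v *)
From Stdlib Require Import ClassicalEpsilon RelationClasses.
Require Import Defs.

Set Implicit Arguments.
Unset Strict Implicit.
Unset Printing Implicit Defensive.

(** Let [F] be a change-of-base functor and [m : M -> A] a morphism such that
    [F m] is the normalisation of an equivalence relation [R] on [F A].  The
    equivalence relation on [A] that should have [m] as normalisation is the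
    smallest reflexive relation relating [0] to [m x] for all [x], that is, the
    join [S] in [A * A] of the diagonal [A -> A * A] and of [(0, m)].

    - [S] exists: it is the image of the morphism out of the coproduct of [A]
      and [M] ([jse_mono_factorizations], [pt_jse_mono_factorizations]).
    - [F S] is isomorphic to [R] over [F A * F A]. Indeed, since [F] is
      coherent, [F S] is the join of the diagonal and of [(0, F m)]. So is [R]:
      it contains both, and by protomodularity it is generated by its
      reflexivity and the kernel [F m] of its first projection
      ([protomodular_pullback_jse], [pt_kernel_section_jse]).
    - What [R] knows descends to [S]: [F] preserves pullbacks and reflects
      isomorphisms, so it reflects the existence of a factorization through a
      given monomorphism ([reflects_factorization]). Symmetry and transitivity
      of [S], and the fact that every morphism killed by the first projection
      of [S] factors through [M], are of this kind.

    The argument uses only the listed properties of [F], and is carried out for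
    a functor between pointed categories ([coherent_reflects_bourn_normal]); the
    rest verifies these properties for categories of points. *)

(** * Monomorphisms, isomorphisms and jointly strongly epimorphic pairs *)

Definition has_pullbacks (C : Category) : Prop :=
  forall (X Y Z : C) (f : Hom X Z) (g : Hom Y Z), inhabited (Pullback f g).

Lemma mono_pullback (C : Category) (A B : C) (f : Hom A B) :
  is_mono f -> is_pullback f f (id A) (id A).
Proof.
  intros Hf. split; [reflexivity|].
  intros T a b e. exists a. split.
  - rewrite comp_id_l. split; [reflexivity | now apply Hf].
  - intros u [<- _]. apply comp_id_l.
Qed.

Lemma pullback_mono (C : Category) (A B : C) (f : Hom A B) :
  is_pullback f f (id A) (id A) -> is_mono f.
Proof.
  intros [_ U] T a b e. destruct (U T a b e) as [u [[<- <-] _]]. reflexivity.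
Qed.

Lemma mono_of_comp (C : Category) (A B D : C) (g : Hom B D) (f : Hom A B) :
  is_mono (g ∘ f) -> is_mono f.
Proof.
  intros H T a b e. apply H. now rewrite <- !comp_assoc, e.
Qed.

Lemma mono_split_epi_iso (C : Category) (A B : C) (f : Hom A B) (g : Hom B A) :
  is_mono f -> f ∘ g = id B -> is_iso f.
Proof.
  intros Hf e. exists g. split; [|exact e].
  apply Hf. now rewrite comp_assoc, e, comp_id_l, comp_id_r.
Qed.

Lemma pb_fst_mono (C : Category) (X Y Z : C) (f : Hom X Z) (g : Hom Y Z)
  (P : Pullback f g) : is_mono g -> is_mono (pb_fst P).
Proof.
  intros Hg T a b e. apply (pb_ext (P := P)); [exact e|].
  apply Hg. now rewrite !comp_assoc, <- pb_comm, <- !comp_assoc, e.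
Qed.

(** A join lies below a subobject as soon as both of its parts do; [g] turns
    this into a statement about factorizations, the subobject being pulled back
    along [g]. *)
Lemma jse_factor (C : Category) (HC : has_pullbacks C) (X Y Z P W : C)
  (a : Hom X Z) (b : Hom Y Z) (g : Hom Z P) (j : Hom W P) :
  jointly_strongly_epi a b -> is_mono j ->
  (exists a', j ∘ a' = g ∘ a) -> (exists b', j ∘ b' = g ∘ b) ->
  exists h, j ∘ h = g.
Proof.
  intros Hab Hj [a' Ha] [b' Hb].
  destruct (HC _ _ _ g j) as [Q].
  destruct (Hab _ (pb_fst Q)) as [q [_ Hq]].
  - now apply pb_fst_mono.
  - exists (pb_lift Q (eq_sym Ha)). apply pb_fst_lift.
  - exists (pb_lift Q (eq_sym Hb)). apply pb_fst_lift.
  - exists (pb_snd Q ∘ q).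
    now rewrite comp_assoc, <- pb_comm, <- comp_assoc, Hq, comp_id_r.
Qed.

Lemma jse_through (C : Category) (X X' Y Z : C)
  (a : Hom X Z) (b : Hom Y Z) (w : Hom X' X) :
  jointly_strongly_epi (a ∘ w) b -> jointly_strongly_epi a b.
Proof.
  intros H M m Hm [a' <-] Hb. apply H; trivial.
  exists (a' ∘ w). apply comp_assoc.
Qed.

(** * Zero objects and zero maps *)

Lemma to_zero_unique (C : Category) (Z A : C) (u v : Hom A Z) :
  is_zero_object Z -> u = v.
Proof.
  intros [H _]. destruct (H A) as [w [_ Hw]].
  transitivity w; [symmetry|]; now apply Hw.
Qed.

Lemma from_zero_unique (C : Category) (Z A : C) (u v : Hom Z A) :
  is_zero_object Z -> u = v.
Proof.
  intros [_ H]. destruct (H A) as [w [_ Hw]].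
  transitivity w; [symmetry|]; now apply Hw.
Qed.

Lemma zero_map_unique (C : Category) (A B : C) (u v : Hom A B) :
  is_zero_map u -> is_zero_map v -> u = v.
Proof.
  intros (Z & a & b & HZ & ->) (Z' & a' & b' & HZ' & ->).
  destruct (proj1 HZ' Z) as [w _].
  rewrite (to_zero_unique a' (w ∘ a) HZ'), comp_assoc.
  now rewrite (from_zero_unique (b' ∘ w) b HZ).
Qed.

Lemma terminal_is_zero (C : Category) (T : C) :
  pointed C -> (forall A : C, exists! f : Hom A T, True) -> is_zero_object T.
Proof.
  intros [Z HZ] HT. split; [exact HT|]. intros A.
  destruct (HT Z) as [t _]. destruct (proj2 HZ A) as [z _].
  destruct (proj1 HZ T) as [s _].
  assert (e : t ∘ s = id T).
  { destruct (HT T) as [w [_ Hw]]. transitivity w; [symmetry|]; now apply Hw. }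
  exists (z ∘ s). split; [trivial|]. intros g _.
  rewrite <- (comp_id_r g), <- e, comp_assoc.
  now rewrite (from_zero_unique (g ∘ t) z HZ).
Qed.

(** * Functors preserving pullbacks *)

Definition preserves_pullbacks (C D : Category) (F : Functor C D) : Prop :=
  forall (P X Y Z : C) (f : Hom X Z) (g : Hom Y Z) (p1 : Hom P X) (p2 : Hom P Y),
    is_pullback f g p1 p2 ->
    is_pullback (fmap F f) (fmap F g) (fmap F p1) (fmap F p2).

Definition preserves_zero_objects (C D : Category) (F : Functor C D) : Prop :=
  forall Z : C, is_zero_object Z -> is_zero_object (F Z).

Lemma cospan_cone_limit (C : Category) (X Y Z P : C) (f : Hom X Z) (g : Hom Y Z)
  (p1 : Hom P X) (p2 : Hom P Y) (H : is_pullback f g p1 p2) :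
  is_limit (cospan_cone (proj1 H)).
Proof.
  intros c.
  pose (l := leg c : forall j, Hom (apex c) (cospan_diagram f g j)).
  assert (El : f ∘ l cospan_l = l cospan_m)
    by exact (leg_natural c (tt : @Hom cospan_shape cospan_l cospan_m)).
  assert (Er : g ∘ l cospan_r = l cospan_m)
    by exact (leg_natural c (tt : @Hom cospan_shape cospan_r cospan_m)).
  destruct (proj2 H _ (l cospan_l) (l cospan_r)) as [u [[Hl Hr] Uu]].
  { now rewrite El, Er. }
  exists u. split.
  - intros []; [exact Hl | exact Hr |].
    change (f ∘ p1 ∘ u = l cospan_m). now rewrite <- comp_assoc, Hl.
  - intros v Hv. apply Uu. split; [exact (Hv cospan_l) | exact (Hv cospan_r)].
Qed.

Lemma preserves_finite_limits_pullbacks (C D : Category) (F : Functor C D) :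
  preserves_finite_limits F -> preserves_pullbacks F.
Proof.
  intros HF P X Y Z f g p1 p2 H.
  pose proof (HF _ cospan_shape_finite _ _ (cospan_cone_limit H)) as L.
  split.
  { rewrite <- !fmap_comp. f_equal. exact (proj1 H). }
  intros T a b e.
  pose (legs := fun j : cospan_shape =>
    match j return Hom T (functor_comp F (cospan_diagram f g) j) with
    | cospan_l => a | cospan_r => b | cospan_m => fmap F f ∘ a end).
  assert (N : forall (i j : cospan_shape) (u : Hom i j),
    fmap (functor_comp F (cospan_diagram f g)) u ∘ legs i = legs j).
  { intros [] [] u; cbn in *; try destruct u;
      rewrite ?fmap_id, ?comp_id_l; congruence. }
  destruct (L (Build_Cone N)) as [u [Hu Uu]].
  exists u. split.
  - split; [exact (Hu cospan_l) | exact (Hu cospan_r)].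
  - intros v [Ha Hb]. apply Uu. intros []; [exact Ha | exact Hb |].
    change (fmap F (f ∘ p1) ∘ v = fmap F f ∘ a).
    now rewrite fmap_comp, <- comp_assoc, Ha.
Qed.

Definition empty_shape : Category.
Proof.
  refine {| Ob := Empty_set; Hom := fun _ _ => Empty_set;
    id := fun a => match a with end;
    comp := fun a _ _ _ _ => match a with end |}; intros [].
Defined.

Lemma empty_shape_finite : finite_category empty_shape.
Proof. split; [exists nil; intros [] | intros []]. Qed.

Definition empty_diagram (C : Category) : Functor empty_shape C.
Proof.
  refine (@Build_Functor empty_shape C (fun a => match a with end)
    (fun a _ _ => match a with end) _ _); intros [].
Defined.

(** A zero object is in particular terminal, that is, a limit of the empty
    diagram. *)
Lemma preserves_finite_limits_zero (C D : Category) (F : Functor C D) :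
  pointed D -> preserves_finite_limits F -> preserves_zero_objects F.
Proof.
  intros HD HF Z HZ. apply terminal_is_zero; [exact HD|]. intros T.
  pose (c := @Build_Cone empty_shape C (empty_diagram C) Z
    (fun j => match j with end) (fun i => match i with end)).
  assert (Hc : is_limit c).
  { intros c'. destruct (proj1 HZ (apex c')) as [u [_ Uu]].
    exists u. split; [intros [] | intros v _; now apply Uu]. }
  destruct (HF _ empty_shape_finite _ _ Hc
    (@Build_Cone empty_shape D (functor_comp F (empty_diagram C)) T
      (fun j => match j with end) (fun i => match i with end))) as [u [_ Uu]].
  exists u. split; [trivial|]. intros v _. apply Uu. intros [].
Qed.

Lemma preserves_pullbacks_mono (C D : Category) (F : Functor C D) (A B : C)
  (f : Hom A B) : preserves_pullbacks F -> is_mono f -> is_mono (fmap F f).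
Proof.
  intros HF Hf. apply pullback_mono. rewrite <- fmap_id.
  now apply HF, mono_pullback.
Qed.

(** The diagonal of the kernel pair of [f] is invertible because its image
    under [F] is. *)
Lemma reflects_monos (C D : Category) (F : Functor C D) (A B : C) (f : Hom A B) :
  has_pullbacks C -> preserves_pullbacks F -> reflects_isos F ->
  is_mono (fmap F f) -> is_mono f.
Proof.
  intros HC HF HI Hf.
  destruct (HC _ _ _ f f) as [K].
  pose (FK := Build_Pullback (HF _ _ _ _ _ _ _ _ (pb_is_pullback K))).
  pose (d := pb_lift K (eq_refl (f ∘ id A))).
  assert (d1 : pb_fst K ∘ d = id A) by apply pb_fst_lift.
  assert (d2 : pb_snd K ∘ d = id A) by apply pb_snd_lift.
  assert (e : fmap F (pb_fst K) = fmap F (pb_snd K))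
    by exact (Hf _ _ _ (pb_comm FK)).
  destruct (HI _ _ d) as [c [_ Hc]].
  { exists (fmap F (pb_fst K)). split; [now rewrite <- fmap_comp, d1, fmap_id|].
    apply (pb_ext (P := FK)); cbn; rewrite comp_assoc, <- fmap_comp, ?d1, ?d2;
      now rewrite fmap_id, comp_id_l, comp_id_r. }
  assert (E : pb_fst K = pb_snd K).
  { rewrite <- (comp_id_r (pb_fst K)), <- (comp_id_r (pb_snd K)), <- Hc.
    now rewrite !comp_assoc, d1, d2. }
  intros T a b ab.
  transitivity (pb_fst K ∘ pb_lift K ab); [symmetry; apply pb_fst_lift|].
  rewrite E. apply pb_snd_lift.
Qed.

(** Factoring [g] through a monomorphism [i] amounts to inverting the pullback
    of [i] along [g]; [F] turns the latter into the pullback of [F i] along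
    [F g], which [h] inverts. *)
Lemma reflects_factorization (C D : Category) (F : Functor C D) (T W P : C)
  (g : Hom T P) (i : Hom W P) (h : Hom (F T) (F W)) :
  has_pullbacks C -> preserves_pullbacks F -> reflects_isos F ->
  is_mono i -> fmap F i ∘ h = fmap F g -> exists g' : Hom T W, i ∘ g' = g.
Proof.
  intros HC HF HI Hi e.
  destruct (HC _ _ _ g i) as [Q].
  pose (FQ := Build_Pullback (HF _ _ _ _ _ _ _ _ (pb_is_pullback Q))).
  destruct (HI _ _ (pb_fst Q)) as [q [_ Hq]].
  { assert (e' : fmap F g ∘ id (F T) = fmap F i ∘ h) by now rewrite comp_id_r.
    apply (@mono_split_epi_iso _ _ _ _ (pb_lift FQ e')).
    - now apply preserves_pullbacks_mono, pb_fst_mono.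
    - exact (pb_fst_lift FQ e'). }
  exists (pb_snd Q ∘ q).
  now rewrite comp_assoc, <- pb_comm, <- comp_assoc, Hq, comp_id_r.
Qed.

(** * Coherent conservative functors reflect Bourn-normal monomorphisms *)

(** Joins of two subobjects, for arbitrary morphisms instead of subobjects. *)
Definition has_jse_mono_factorizations (C : Category) : Prop :=
  forall (A B P : C) (u : Hom A P) (v : Hom B P),
  exists (I : C) (i : Hom I P) (u' : Hom A I) (v' : Hom B I),
    is_mono i /\ i ∘ u' = u /\ i ∘ v' = v /\ jointly_strongly_epi u' v'.

(** The form that protomodularity takes in a pointed category. *)
Definition kernel_section_jse (C : Category) : Prop :=
  forall (K R A : C) (r : Hom R A) (s : Hom A R) (k : Hom K R),
    r ∘ s = id A -> is_kernel r k -> jointly_strongly_epi k s.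

(** The relation [S] generated by reflexivity and [m] is sent by [F] to the
    given relation [R], and inherits from it all the properties required. *)
Theorem coherent_reflects_bourn_normal (C D : Category) (F : Functor C D) :
  pointed C -> has_pullbacks C -> has_pullbacks D ->
  has_jse_mono_factorizations C -> kernel_section_jse D ->
  preserves_zero_objects F -> coherent F -> reflects_isos F ->
  reflects_bourn_normal_monos F.
Proof.
  intros [Z HZ] HC HD HJ HK HFZ [HL HFJ] HI M A m [Hm [R [r1 [r2 [k [ER [Kk Em]]]]]]].
  pose proof (preserves_finite_limits_pullbacks HL) as HF.
  assert (Mm : is_mono m) by exact (reflects_monos HC HF HI Hm).
  split; [exact Mm|].
  (* The products of [A] and of [F A] with themselves are pullbacks over [Z] and
     [F Z]. *)
  destruct (proj1 HZ A) as [z _]. destruct (proj1 HZ M) as [zM _].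
  destruct (proj2 HZ A) as [o _].
  destruct (HC _ _ _ z z) as [P].
  pose (FP := Build_Pullback (HF _ _ _ _ _ _ _ _ (pb_is_pullback P))).
  assert (e0 : forall T (a b : Hom T A), z ∘ a = z ∘ b)
    by (intros; now apply to_zero_unique).
  assert (E0 : forall T (a b : Hom T (F A)), fmap F z ∘ a = fmap F z ∘ b)
    by (intros; now apply to_zero_unique, HFZ).
  (* [S] is the join of the diagonal and [(0, m)]. *)
  destruct (HJ _ _ _ (pb_lift P (e0 _ (id A) (id A))) (pb_lift P (e0 _ (o ∘ zM) m)))
    as (S & i & u & v & Mi & iu & iv & Juv).
  pose (s1 := pb_fst P ∘ i). pose (s2 := pb_snd P ∘ i).
  assert (s1u : s1 ∘ u = id A) by (unfold s1; rewrite <- comp_assoc, iu; apply pb_fst_lift).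
  assert (s2u : s2 ∘ u = id A) by (unfold s2; rewrite <- comp_assoc, iu; apply pb_snd_lift).
  assert (s1v : s1 ∘ v = o ∘ zM) by (unfold s1; rewrite <- comp_assoc, iv; apply pb_fst_lift).
  assert (s2v : s2 ∘ v = m) by (unfold s2; rewrite <- comp_assoc, iv; apply pb_snd_lift).
  assert (JM : forall T (a b : Hom T S), s1 ∘ a = s1 ∘ b -> s2 ∘ a = s2 ∘ b -> a = b).
  { unfold s1, s2. intros T a b h1 h2. rewrite <- !comp_assoc in h1, h2.
    apply Mi. now apply (pb_ext (P := P)). }
  assert (MFi : is_mono (fmap F i)) by now apply preserves_pullbacks_mono.
  destruct (@Equivalence_Reflexive _ _ (er_equivalence ER (F A)) (id (F A)))
    as [d [d1 d2]].
  (* [R] and [F S] are compared as subobjects of the product of [F A] with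
     itself: [j] and [F i] factor through each other. *)
  pose (j := pb_lift FP (E0 _ r1 r2) : Hom R (F (pb_ob P))).
  assert (j1 : fmap F (pb_fst P) ∘ j = r1) by exact (pb_fst_lift FP _).
  assert (j2 : fmap F (pb_snd P) ∘ j = r2) by exact (pb_snd_lift FP _).
  assert (Mj : is_mono j).
  { intros T a b e. apply (er_jointly_monic ER).
    - now rewrite <- j1, <- !comp_assoc, e.
    - now rewrite <- j2, <- !comp_assoc, e. }
  assert (jd : j ∘ d = fmap F i ∘ fmap F u).
  { apply (pb_ext (P := FP)); cbn; rewrite !comp_assoc, ?j1, ?j2, <- !fmap_comp.
    - fold s1. now rewrite s1u, fmap_id.
    - fold s2. now rewrite s2u, fmap_id. }
  assert (ZF : is_zero_map (fmap F (o ∘ zM))).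
  { exists (F Z), (fmap F zM), (fmap F o).
    split; [now apply HFZ | apply fmap_comp]. }
  assert (jk : j ∘ k = fmap F i ∘ fmap F v).
  { apply (pb_ext (P := FP)); cbn; rewrite !comp_assoc, ?j1, ?j2, <- !fmap_comp.
    - fold s1. rewrite s1v. apply zero_map_unique; [exact (proj1 Kk) | exact ZF].
    - fold s2. now rewrite s2v, Em. }
  destruct (jse_factor HD (g := fmap F i) (j := j) (HFJ _ _ _ _ _ Juv) Mj) as [phi Hphi].
  { now exists d. }
  { now exists k. }
  destruct (jse_factor HD (g := j) (j := fmap F i) (HK _ _ _ _ _ _ d1 Kk) MFi)
    as [psi Hpsi].
  { now exists (fmap F v). }
  { now exists (fmap F u). }
  assert (phi1 : r1 ∘ phi = fmap F s1)
    by (unfold s1; now rewrite fmap_comp, <- Hphi, comp_assoc, j1).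
  assert (phi2 : r2 ∘ phi = fmap F s2)
    by (unfold s2; now rewrite fmap_comp, <- Hphi, comp_assoc, j2).
  assert (psi1 : fmap F s1 ∘ psi = r1)
    by (unfold s1; now rewrite fmap_comp, <- comp_assoc, Hpsi, j1).
  assert (psi2 : fmap F s2 ∘ psi = r2)
    by (unfold s2; now rewrite fmap_comp, <- comp_assoc, Hpsi, j2).
  (* Two generalized elements of [A] are related by [S] if and only if their
     images under [F] are related by [R]. *)
  assert (rel : forall T (x y : Hom T A),
    (exists a : Hom (F T) R, r1 ∘ a = fmap F x /\ r2 ∘ a = fmap F y) ->
    exists a : Hom T S, s1 ∘ a = x /\ s2 ∘ a = y).
  { intros T x y [a [a1 a2]].
    destruct (@reflects_factorization _ _ F _ _ _ (pb_lift P (e0 _ x y)) i (psi ∘ a)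
      HC HF HI Mi) as [t Ht].
    - apply (pb_ext (P := FP)); cbn; rewrite <- fmap_comp, ?pb_fst_lift, ?pb_snd_lift,
        !comp_assoc, <- fmap_comp.
      + fold s1. now rewrite psi1.
      + fold s2. now rewrite psi2.
    - exists t. unfold s1, s2. rewrite <- !comp_assoc, Ht.
      split; [apply pb_fst_lift | apply pb_snd_lift]. }
  assert (relF : forall T (x y : Hom T A),
    (exists a : Hom T S, s1 ∘ a = x /\ s2 ∘ a = y) ->
    exists a : Hom (F T) R, r1 ∘ a = fmap F x /\ r2 ∘ a = fmap F y).
  { intros T x y [a [<- <-]]. exists (phi ∘ fmap F a).
    now rewrite !comp_assoc, phi1, phi2, !fmap_comp. }
  exists S, s1, s2, v. split; [split|split].
  - exact JM.
  - intros T. pose proof (er_equivalence ER (F T)) as E. split.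
    + intros x. exists (u ∘ x). now rewrite !comp_assoc, s1u, s2u, comp_id_l.
    + intros x y H. apply rel.
      exact (@Equivalence_Symmetric _ _ E _ _ (relF _ _ _ H)).
    + intros x y w H1 H2. apply rel.
      exact (@Equivalence_Transitive _ _ E _ _ _ (relF _ _ _ H1) (relF _ _ _ H2)).
  - assert (Mv : is_mono v) by (apply (@mono_of_comp _ _ _ _ s2); now rewrite s2v).
    split; [exists Z, zM, o; now split|].
    intros T t Ht.
    (* [t] factors through [v] since [F t], seen in [R], factors through the
       kernel [k]. *)
    destruct (proj2 Kk _ (phi ∘ fmap F t)) as [w [Hw _]].
    { rewrite comp_assoc, phi1, <- fmap_comp.
      destruct Ht as (Z' & a & b & HZ' & ->).
      exists (F Z'), (fmap F a), (fmap F b). split; [now apply HFZ | apply fmap_comp]. }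
    assert (psik : psi ∘ k = fmap F v).
    { apply MFi. now rewrite comp_assoc, Hpsi. }
    destruct (@reflects_factorization _ _ F _ _ _ t v w HC HF HI Mv) as [g Hg].
    { rewrite <- psik, <- comp_assoc, Hw. apply MFi.
      rewrite !comp_assoc, Hpsi, Hphi. reflexivity. }
    exists g. split; [exact Hg|]. intros g' Hg'. apply Mv. now rewrite Hg, Hg'.
  - now rewrite s2v.
Qed.

(** * Images in a regular category *)

Lemma regular_epi_cancel (C : Category) (B Q T : C) (q : Hom B Q) (a b : Hom Q T) :
  is_regular_epi q -> a ∘ q = b ∘ q -> a = b.
Proof.
  intros (A & u & v & e & U) H.
  destruct (U T (a ∘ q)) as [w [_ Uw]].
  - now rewrite <- !comp_assoc, e.
  - transitivity w; [symmetry|]; apply Uw; congruence.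
Qed.

Lemma regular_epi_strong (C : Category) (B Q M : C) (q : Hom B Q) (m : Hom M Q)
  (q' : Hom B M) : is_regular_epi q -> is_mono m -> m ∘ q' = q -> is_iso m.
Proof.
  intros Hq Hm e. pose proof Hq as (A & u & v & E & U).
  destruct (U M q') as [w [Hw _]].
  - apply Hm. now rewrite !comp_assoc, e.
  - apply (@mono_split_epi_iso _ _ _ _ w Hm).
    apply (regular_epi_cancel Hq). now rewrite <- comp_assoc, Hw, e, comp_id_l.
Qed.

(** The image of [f] is the quotient by its kernel pair. To see that [i] is
    monic, lift [a] and [b] along the regular epimorphism [e] after passing to
    a cover of [T], which exists by pullback stability: the lifts form an
    element of the kernel pair of [f]. *)
Lemma regular_image (C : Category) (A B : C) (f : Hom A B) :
  regular C -> exists (I : C) (e : Hom A I) (i : Hom I B),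
    is_regular_epi e /\ is_mono i /\ i ∘ e = f.
Proof.
  intros HR. pose proof (finite_limits_pullback (regular_finite_limits HR)) as HC.
  destruct (HC _ _ _ f f) as [K].
  destruct (regular_coequalizers HR (pb_is_pullback K)) as (I & e & He).
  pose proof He as [Ke Ue].
  destruct (Ue B f (pb_comm K)) as [i [Hi _]].
  assert (Re : is_regular_epi e) by now exists (pb_ob K), (pb_fst K), (pb_snd K).
  exists I, e, i. split; [exact Re|]. split; [|exact Hi].
  intros T a b ab.
  destruct (HC _ _ _ a e) as [P].
  destruct (HC _ _ _ (b ∘ pb_fst P) e) as [Q].
  apply (regular_epi_cancel (regular_stable HR (pb_is_pullback P) Re)).
  apply (regular_epi_cancel (regular_stable HR (pb_is_pullback Q) Re)).
  rewrite (pb_comm Q), (pb_comm P), <- comp_assoc.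
  assert (E : f ∘ (pb_snd P ∘ pb_fst Q) = f ∘ pb_snd Q).
  { rewrite <- Hi, <- !comp_assoc, <- (pb_comm Q), (comp_assoc e), <- (pb_comm P).
    now rewrite !comp_assoc, ab. }
  transitivity (e ∘ (pb_fst K ∘ pb_lift K E)); [now rewrite pb_fst_lift|].
  now rewrite comp_assoc, Ke, <- comp_assoc, pb_snd_lift.
Qed.

(** The image of the copairing of [u] and [v], regular epimorphisms being
    strong. *)
Lemma jse_mono_factorizations (C : Category) :
  regular C -> has_binary_coproducts C -> has_jse_mono_factorizations C.
Proof.
  intros HR HS A B P u v.
  destruct (HS A B) as (S & a & b & US).
  destruct (US P u v) as [f [[fa fb] _]].
  destruct (regular_image f HR) as (I & e & i & Re & Mi & Ei).
  exists I, i, (e ∘ a), (e ∘ b).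
  split; [exact Mi|]. split; [now rewrite comp_assoc, Ei|].
  split; [now rewrite comp_assoc, Ei|].
  intros N n Hn [a' Ha] [b' Hb].
  destruct (US N a' b') as [g [[ga gb] _]].
  apply (regular_epi_strong (q' := g) Re Hn).
  destruct (US I (e ∘ a) (e ∘ b)) as [w [_ Uw]].
  transitivity w; [symmetry|]; apply Uw; split; trivial;
    now rewrite <- comp_assoc, ?ga, ?gb.
Qed.

(** * Categories of points *)

Definition pt_zero (C : Category) (X : C) : Pt X := Build_pt_ob (comp_id_l (id X)).

Lemma pt_zero_is_zero (C : Category) (X : C) : is_zero_object (pt_zero X).
Proof.
  split; intros A.
  - exists (@Build_pt_hom C X A (pt_zero X) (pt_proj A) (comp_id_l _) (pt_split A)).
    split; [trivial|]. intros u _. apply pt_hom_eq. cbn.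
    rewrite <- (pt_map_proj u). apply comp_id_l.
  - exists (@Build_pt_hom C X (pt_zero X) A (pt_sec A) (pt_split A) (comp_id_r _)).
    split; [trivial|]. intros u _. apply pt_hom_eq. cbn.
    rewrite <- (pt_map_sec u). apply comp_id_r.
Qed.

Lemma pt_pointed (C : Category) (X : C) : pointed (Pt X).
Proof. exists (pt_zero X). apply pt_zero_is_zero. Qed.

Lemma pt_zero_map (C : Category) (X : C) (a b : Pt X) (u : Hom a b) :
  pt_map u = pt_sec b ∘ pt_proj a -> is_zero_map u.
Proof.
  intros e.
  exists (pt_zero X), (@Build_pt_hom C X a (pt_zero X) (pt_proj a) (comp_id_l _) (pt_split a)),
    (@Build_pt_hom C X (pt_zero X) b (pt_sec b) (pt_split b) (comp_id_r _)).
  split; [apply pt_zero_is_zero | now apply pt_hom_eq].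
Qed.

Lemma pt_has_pullbacks (C : Category) (X : C) : has_pullbacks C -> has_pullbacks (Pt X).
Proof.
  intros HC a b c u v. destruct (HC _ _ _ (pt_map u) (pt_map v)) as [P].
  assert (es : pt_map u ∘ pt_sec a = pt_map v ∘ pt_sec b)
    by now rewrite !pt_map_sec.
  assert (ep : pt_proj a ∘ pb_fst P ∘ pb_lift P es = id X)
    by now rewrite <- comp_assoc, pb_fst_lift, pt_split.
  pose (d := Build_pt_ob ep : Pt X).
  assert (e2 : pt_proj b ∘ pb_snd P = pt_proj d).
  { cbn. rewrite <- (pt_map_proj u), <- (pt_map_proj v), <- !comp_assoc.
    now rewrite pb_comm. }
  pose (p1 := @Build_pt_hom C X d a (pb_fst P) eq_refl (pb_fst_lift P es) : Hom d a).
  pose (p2 := @Build_pt_hom C X d b (pb_snd P) e2 (pb_snd_lift P es) : Hom d b).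
  constructor. apply (@Build_Pullback _ _ _ _ _ _ d p1 p2). split.
  - apply pt_hom_eq. exact (pb_comm P).
  - intros t f g e.
    assert (e' : pt_map u ∘ pt_map f = pt_map v ∘ pt_map g)
      by exact (f_equal (@pt_map _ _ _ _) e).
    assert (w1 : pt_proj d ∘ pb_lift P e' = pt_proj t).
    { cbn. rewrite <- comp_assoc, pb_fst_lift. apply pt_map_proj. }
    assert (w2 : pb_lift P e' ∘ pt_sec t = pt_sec d).
    { cbn. apply (pb_ext (P := P)); rewrite comp_assoc, ?pb_fst_lift, ?pb_snd_lift;
        apply pt_map_sec. }
    exists (@Build_pt_hom C X t d _ w1 w2). split.
    + split; apply pt_hom_eq; [apply pb_fst_lift | apply pb_snd_lift].
    + intros w [h1 h2]. apply pt_hom_eq. cbn.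
      apply (pb_ext (P := P)); rewrite ?pb_fst_lift, ?pb_snd_lift.
      * now rewrite <- h1.
      * now rewrite <- h2.
Qed.

Lemma pt_iso (C : Category) (X : C) (a b : Pt X) (u : Hom a b) :
  is_iso (pt_map u) -> is_iso u.
Proof.
  intros [g [h1 h2]].
  assert (e1 : pt_proj a ∘ g = pt_proj b)
    by now rewrite <- (pt_map_proj u), <- comp_assoc, h2, comp_id_r.
  assert (e2 : g ∘ pt_sec b = pt_sec a)
    by now rewrite <- (pt_map_sec u), comp_assoc, h1, comp_id_l.
  exists (@Build_pt_hom C X b a g e1 e2). split; now apply pt_hom_eq.
Qed.

Lemma pt_map_iso (C : Category) (X : C) (a b : Pt X) (u : Hom a b) :
  is_iso u -> is_iso (pt_map u).
Proof.
  intros [g [h1 h2]]. exists (pt_map g). split.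
  - exact (f_equal (@pt_map _ _ _ _) h1).
  - exact (f_equal (@pt_map _ _ _ _) h2).
Qed.

Lemma pt_mono (C : Category) (X : C) (a b : Pt X) (u : Hom a b) :
  is_mono (pt_map u) -> is_mono u.
Proof.
  intros H t f g e. apply pt_hom_eq, H. exact (f_equal (@pt_map _ _ _ _) e).
Qed.

(** The kernel pair of [pt_map u] is again a point over [X], whose projections
    are morphisms of points that [u] identifies. *)
Lemma pt_map_mono (C : Category) (X : C) (a b : Pt X) (u : Hom a b) :
  has_pullbacks C -> is_mono u -> is_mono (pt_map u).
Proof.
  intros HC Hu. destruct (HC _ _ _ (pt_map u) (pt_map u)) as [P].
  pose (s := pb_lift P (eq_refl (pt_map u ∘ pt_sec a))).
  assert (ep : pt_proj a ∘ pb_fst P ∘ s = id X).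
  { unfold s. now rewrite <- comp_assoc, pb_fst_lift, pt_split. }
  pose (d := Build_pt_ob ep : Pt X).
  assert (e2 : pt_proj a ∘ pb_snd P = pt_proj d).
  { cbn. rewrite <- (pt_map_proj u), <- !comp_assoc. now rewrite pb_comm. }
  pose (p1 := @Build_pt_hom C X d a (pb_fst P) eq_refl (pb_fst_lift P _) : Hom d a).
  pose (p2 := @Build_pt_hom C X d a (pb_snd P) e2 (pb_snd_lift P _) : Hom d a).
  assert (E : p1 = p2) by (apply Hu, pt_hom_eq; exact (pb_comm P)).
  apply (f_equal (@pt_map _ _ _ _)) in E. cbn in E.
  intros T f g e. rewrite <- (pb_fst_lift P e), E. apply pb_snd_lift.
Qed.

Lemma pt_jse (C : Category) (X : C) (a b c : Pt X) (u : Hom a c) (v : Hom b c) :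
  has_pullbacks C -> jointly_strongly_epi (pt_map u) (pt_map v) ->
  jointly_strongly_epi u v.
Proof.
  intros HC H n m Hm [u' Hu] [v' Hv]. apply pt_iso, H.
  - now apply pt_map_mono.
  - exists (pt_map u'). now rewrite <- Hu.
  - exists (pt_map v'). now rewrite <- Hv.
Qed.

(** The factorization in [C] is one in [Pt X]: the middle object receives a
    section from [a] and a projection from [p]. *)
Lemma pt_jse_mono_factorizations (C : Category) (X : C) :
  has_pullbacks C -> has_jse_mono_factorizations C -> has_jse_mono_factorizations (Pt X).
Proof.
  intros HC HJ a b p u v.
  destruct (HJ _ _ _ (pt_map u) (pt_map v)) as (I & i & u' & v' & Mi & Hu & Hv & J).
  assert (es : u' ∘ pt_sec a = v' ∘ pt_sec b).
  { apply Mi. now rewrite !comp_assoc, Hu, Hv, !pt_map_sec. }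
  assert (ep : pt_proj p ∘ i ∘ (u' ∘ pt_sec a) = id X).
  { rewrite <- comp_assoc, (comp_assoc i), Hu, pt_map_sec. apply pt_split. }
  pose (d := Build_pt_ob ep : Pt X).
  assert (i2 : i ∘ pt_sec d = pt_sec p)
    by (cbn; now rewrite comp_assoc, Hu, pt_map_sec).
  assert (u1 : pt_proj d ∘ u' = pt_proj a)
    by (cbn; now rewrite <- comp_assoc, Hu, pt_map_proj).
  assert (v1 : pt_proj d ∘ v' = pt_proj b)
    by (cbn; now rewrite <- comp_assoc, Hv, pt_map_proj).
  exists d, (@Build_pt_hom C X d p i eq_refl i2), (@Build_pt_hom C X a d u' u1 eq_refl),
    (@Build_pt_hom C X b d v' v1 (eq_sym es)).
  repeat split.
  - now apply pt_mono.
  - now apply pt_hom_eq.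
  - now apply pt_hom_eq.
  - now apply pt_jse.
Qed.

(** * Protomodularity *)

(** A subobject [m] of [a] containing the section is a morphism of points. If
    it also contains the pullback of [a] along [f], then its change of base along
    [f] is invertible, whence so is [m]. *)
Lemma protomodular_pullback_jse (C : Category) (HP : protomodular C) (X Y : C)
  (f : Hom X Y) (a : Pt Y) :
  jointly_strongly_epi (pb_snd (cob_pb (pm_pullbacks HP) f a)) (pt_sec a).
Proof.
  intros M m Hm [q Hq] [s Hs].
  assert (ep : pt_proj a ∘ m ∘ s = id Y) by now rewrite <- comp_assoc, Hs, pt_split.
  pose (b := Build_pt_ob ep : Pt Y).
  pose (n := @Build_pt_hom C Y b a m eq_refl Hs : Hom b a).
  change (is_iso (pt_map n)). apply pt_map_iso.
  apply (pm_reflects_isos (p := HP) (f := f)), pt_iso. cbn.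
  set (Qa := cob_pb (pm_pullbacks HP) f a) in *.
  set (Qb := cob_pb (pm_pullbacks HP) f b) in *.
  assert (e : f ∘ pb_fst Qa = pt_proj b ∘ q)
    by (cbn; now rewrite <- comp_assoc, Hq, pb_comm).
  apply (@mono_split_epi_iso _ _ _ _ (pb_lift Qb e)).
  - intros T x y E. apply (pb_ext (P := Qb)).
    + apply (f_equal (comp (pb_fst Qa))) in E.
      now rewrite !comp_assoc, pb_fst_lift in E.
    + apply (f_equal (comp (pb_snd Qa))) in E.
      rewrite !comp_assoc, pb_snd_lift, <- !comp_assoc in E. now apply Hm.
  - apply (pb_ext (P := Qa)); rewrite comp_assoc, ?pb_fst_lift, ?pb_snd_lift, comp_id_r.
    + reflexivity.
    + cbn. rewrite <- comp_assoc, pb_snd_lift. exact Hq.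
Qed.

(** The kernel in [Pt X] of a split epimorphism [r : R -> A] is the pullback of
    [r] along the section [X -> A], so that [protomodular_pullback_jse] applies
    to [R] as a point over [A]. *)
Lemma pt_kernel_section_jse (C : Category) (X : C) :
  protomodular C -> has_pullbacks C -> kernel_section_jse (Pt X).
Proof.
  intros HP HC K R A r s k rs [_ Uk].
  pose (a := Build_pt_ob (f_equal (@pt_map _ _ _ _) rs) : Pt (pt_dom A)).
  pose (Q := cob_pb (pm_pullbacks HP) (pt_sec A) a : Pullback (pt_sec A) (pt_map r)).
  pose proof (@protomodular_pullback_jse C HP _ _ (pt_sec A) a) as J. fold Q in J.
  assert (es : pt_sec A ∘ id X = pt_proj a ∘ pt_sec R)
    by (cbn; now rewrite comp_id_r, pt_map_sec).
  pose (d := Build_pt_ob (pb_fst_lift Q es) : Pt X).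
  assert (Qc : pt_map r ∘ pb_snd Q = pt_sec A ∘ pb_fst Q) by exact (eq_sym (pb_comm Q)).
  assert (e1 : pt_proj R ∘ pb_snd Q = pt_proj d).
  { cbn. rewrite <- (pt_map_proj r), <- comp_assoc, Qc, comp_assoc, pt_split.
    apply comp_id_l. }
  pose (q := @Build_pt_hom C X d R (pb_snd Q) e1 (pb_snd_lift Q es) : Hom d R).
  destruct (Uk d q) as [w [Hw _]].
  { now apply pt_zero_map. }
  apply (@jse_through _ _ _ _ _ k s w). rewrite Hw.
  now apply pt_jse.
Qed.

(** * Algebraic coherence and strong protomodularity *)

Theorem theorem6p24 (C : Category) (hsa : semi_abelian C)
  (hac : algebraically_coherent C) : strongly_protomodular C.
Proof.
  destruct hsa as [H0 [HR _] HP HS], hac as [HL HF].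
  pose proof (finite_limits_pullback HL) as HC.
  apply (@Build_strongly_protomodular C H0 HP). intros X Y f.
  (* The functor [change_of_base] depends on a proof that pullbacks exist, and
     the two hypotheses supply different proofs. *)
  rewrite (proof_irrelevance _ (pm_pullbacks HP) (finite_limits_split_epi_pullbacks HL)).
  apply coherent_reflects_bourn_normal.
  - apply pt_pointed.
  - now apply pt_has_pullbacks.
  - now apply pt_has_pullbacks.
  - now apply pt_jse_mono_factorizations, jse_mono_factorizations.
  - now apply pt_kernel_section_jse.
  - apply preserves_finite_limits_zero; [apply pt_pointed | apply HF].
  - apply HF.
  - rewrite <- (proof_irrelevance _ (pm_pullbacks HP) (finite_limits_split_epi_pullbacks HL)).
    apply pm_reflects_isos.
Qed.
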